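(* Let $Z=(Z_{\mathbf{x},t})_{(\mathbf{x},t)\in D\times\mathcal{T}}$ and $\tilde Z=(\tilde Z_{\mathbf{x},t})_{(\mathbf{x},t)\in D\times\mathcal{T}}$ be two measurable real-valued random fields on $(\Omega,\mathcal{F},P)$ that are exponentially integrable alongside $\mathcal{T}$. For $(\mathbf{x},t,t')\in D\times\mathcal{T}^2$ let $\Delta Z_{\mathbf{x},t,t'}:=Z_{\mathbf{x},t}-Z_{\mathbf{x},t'}$ and $\Delta\tilde Z_{\mathbf{x},t,t'}:=\tilde Z_{\mathbf{x},t}-\tilde Z_{\mathbf{x},t'}$. Consider the statements: (1) $(\Delta Z_{\mathbf{x},t,t'})_{(\mathbf{x},t,t')\in D\times\mathcal{T}^2}$ is indistinguishable from $(\Delta\tilde Z_{\mathbf{x},t,t'})_{(\mathbf{x},t,t')\in D\times\mathcal{T}^2}$; (2) $\Psi[Z]$ is indistinguishable from $\Psi[\tilde Z]$; (3) $\mathrm{LRPMF}(Z)$ is indistinguishable from $\mathrm{LRPMF}(\tilde Z)$. Then (1) $\Leftrightarrow$ (2) and (2) $\Rightarrow$ (3). If, additionally, $Z$ and $\tilde Z$ are almost surely continuous (and separable), then (3) $\Rightarrow$ (2).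
   Context: $(\Omega,\mathcal{F},P)$ is the ambient probability space. $D\subset\mathbb{R}^{d_D}$ ($d_D\ge1$) is compact and convex; $\mathcal{T}\subset\mathbb{R}$ is compact and convex with $\lambda(\mathcal{T})>0$, where $\lambda$ is Lebesgue measure; $\mathcal{B}(\mathcal{T})$ is the Borel $\sigma$-algebra of $\mathcal{T}$. A measurable random field $Z$ on $D\times\mathcal{T}$ is exponentially integrable alongside $\mathcal{T}$ if $\int_{\mathcal{T}}e^{Z_{\mathbf{x},u}(\omega)}\,d\lambda(u)<\infty$ for every $(\mathbf{x},\omega)\in D\times\Omega$. For such $Z$, $$\Psi[Z](\mathbf{x},t)=\frac{e^{Z_{\mathbf{x},t}}}{\int_{\mathcal{T}}e^{Z_{\mathbf{x},u}}\,d\lambda(u)},\qquad (\mathbf{x},t)\in D\times\mathcal{T},$$ and $\mathrm{LRPMF}(Z)=(\Xi_{\mathbf{x}})_{\mathbf{x}\in D}$ is the logistic random probability measure field defined by $\Xi_{\mathbf{x}}(B)=\int_B\Psi[Z](\mathbf{x},u)\,d\lambda(u)$ for $\mathbf{x}\in D$, $B\in\mathcal{B}(\mathcal{T})$. Two random fields with the same index set and defined on the same probability space are indistinguishable if, with probability one, they coincide simultaneously at all indices; two random measure fields $\Xi,\tilde\Xi$ are indistinguishable if, with probability one, $\Xi_{\mathbf{x}}(B)=\tilde\Xi_{\mathbf{x}}(B)$ for all $\mathbf{x}\in D$ and all $B\in\mathcal{B}(\mathcal{T})$. *)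

(* Defs.v *)
From HB Require Import structures.
From mathcomp Require Import all_boot all_order all_algebra.
From mathcomp Require Import all_classical all_reals all_analysis.
Import Order.TTheory GRing.Theory Num.Theory.
Import numFieldNormedType.Exports.

Set Implicit Arguments.
Unset Strict Implicit.
Unset Printing Implicit Defensive.

Local Open Scope classical_set_scope.
Local Open Scope ring_scope.

(* A random field on (Omega, P) with index set A : set I is a total function
   X : I -> Omega -> V; only the values X i with A i are meaningful, and every
   notion below looks at those values only. *)

Definition borelType (I : ptopologicalType) := g_sigma_algebraType (@open I).

(* Joint measurability of (x, t, w) |-> Z (x, t) w with respect to the trace of
   B(E) (x) B(R) (x) F on D x T x Om. *)
Definition measurable_field (E : ptopologicalType) (R : realType)
    (dOm : measure_display) (Om : measurableType dOm)
    (D : set E) (T : set R) (Z : E * R -> Om -> R) :=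
  measurable_fun ((D : set (borelType E)) `*` T `*` [set: Om])
    (fun p : (borelType E * R * Om)%type => Z p.1 p.2).

(* "With probability one" is {ae P, _}: the event contains a measurable set of
   probability one. The quantification over an uncountable index set need not
   yield a measurable event. *)
Definition indistinguishable (I V : Type) (dOm : measure_display)
    (Om : measurableType dOm) (R : realType) (P : probability Om R)
    (A : set I) (X Y : I -> Om -> V) :=
  {ae P, forall w, forall i, A i -> X i w = Y i w}.

Definition measure_field_indistinguishable (I U : Type)
    (dOm : measure_display) (Om : measurableType dOm) (R : realType)
    (P : probability Om R) (A : set I) (S : set (set U))
    (Xi Xi' : I -> Om -> set U -> \bar R) :=
  {ae P, forall w, forall i B, A i -> S B -> Xi i w B = Xi' i w B}.

Definition as_continuous (I : topologicalType) (dOm : measure_display)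
    (Om : measurableType dOm) (R : realType) (P : probability Om R)
    (A : set I) (X : I -> Om -> R) :=
  {ae P, forall w, {within A, continuous (fun i => X i w)}}.

(* Doob separability: S is a countable dense subset of A and N a P-null event;
   `+` is the symmetric difference. *)
Definition separable_field (I : topologicalType) (dOm : measure_display)
    (Om : measurableType dOm) (R : realType) (P : probability Om R)
    (A : set I) (X : I -> Om -> R) :=
  exists (S : set I) (N : set Om),
    [/\ countable S, S `<=` A /\ A `<=` closure S, measurable N /\ P N = 0%E
      & forall (G : set I) (F : set R), open G -> closed F ->
          [set w | forall i, (A `&` G) i -> F (X i w)] `+`
          [set w | forall i, (S `&` G) i -> F (X i w)] `<=` N].

Section logistic.
Context (R : realType) (E : Type) (dOm : measure_display)
  (Om : measurableType dOm).
Implicit Types (D : set E) (T : set R) (Z : E * R -> Om -> R).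

Definition exp_integrable_alongside D T Z :=
  forall x w, D x ->
    (\int[lebesgue_measure]_(u in T) (expR (Z (x, u) w))%:E < +oo)%E.

Definition increment_field Z (i : E * R * R) (w : Om) : R :=
  Z (i.1.1, i.1.2) w - Z (i.1.1, i.2) w.

Definition Psi T Z (i : E * R) (w : Om) : R :=
  expR (Z i w) / \int[lebesgue_measure]_(u in T) expR (Z (i.1, u) w).

Definition LRPMF T Z (x : E) (w : Om) (B : set R) : \bar R :=
  (\int[lebesgue_measure]_(u in B) (Psi T Z (x, u) w)%:E)%E.

End logistic.

(* Main.v *)
(** Fix x and w, and write g u = Z (x, u) w and h u = Z' (x, u) w. Taking
    logarithms, the two densities agree at t iff g t - h t equals the difference
    c of the log-normalisers, so they agree on all of T exactly when g - h is
    constant there. If the measures agree, then g - h = c almost everywhere on T;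
    as every relative neighbourhood of a point of a nondegenerate interval has
    positive length, continuity upgrades this to all of T. *)

Require Import Defs.
From HB Require Import structures.
From mathcomp Require Import all_boot all_order all_algebra.
From mathcomp Require Import all_classical all_reals all_analysis.
From mathcomp Require Import ring lra.
Import Order.TTheory GRing.Theory Num.Theory.
Import numFieldNormedType.Exports.
Local Open Scope classical_set_scope.
Local Open Scope ring_scope.

Section logistic_density.
Context {R : realType}.
Local Notation mu := (@lebesgue_measure R).
Implicit Types (T U : set R) (g h : R -> R).

Lemma convex_set_is_interval T :
  convex_set (T : set (convex_lmodType R^o)) -> is_interval T.
Proof.
move=> cT a b Ta Tb c /andP[ac cb].
have [ab|ab] := eqVneq a b.
  by have -> : c = a by apply/eqP; rewrite eq_le ac andbT ab.
have ba0 : 0 < b - a by rewrite subr_gt0 lt_neqAle ab (le_trans ac).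
(* This is the weight of [a] in [c] as a convex combination of [a] and [b]. *)
have l0 : 0 <= (b - c) / (b - a) by rewrite divr_ge0 ?(ltW ba0) ?subr_ge0.
have l1 : (b - c) / (b - a) <= 1 by rewrite ler_pdivrMr // mul1r lerB.
have := cT a b (Itv01 l0 l1) (mem_set Ta) (mem_set Tb).
rewrite inE => Tab.
have <- : conv (Itv01 l0 l1) (a : R^o) (b : R^o) = c; last exact: Tab.
by rewrite convRE /= /unstable.onem; field; rewrite gt_eqF.
Qed.

(** Positive length gives [T] a second point [s]. The open segment from [t] towards [s], cut off at
    distance [e] from [t], is nondegenerate and lies in both [T] and [U]. *)
Lemma interval_nbhs_not_negligible {T U} {t : R} :
  is_interval T -> (0 < mu T)%E -> T t -> nbhs t U ->
  ~ mu.-negligible (T `&` U).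
Proof.
move=> iT T_pos Tt /nbhs_ballP[e /= e0 teU] negTU.
have no_itv a b : a < b -> [set` `]a, b[] `<=` T `&` U -> False.
  move=> ab abTU.
  have : mu [set` `]a, b[] = 0%E.
    apply: measure_negligible; first exact: measurable_itv.
    exact: (negligibleS (mu := mu) abTU negTU).
  rewrite lebesgue_measure_itv /= lte_fin ab => /eqP.
  by rewrite -EFinB eqe subr_eq0 gt_eqF.
have [s Ts st] : exists2 s, T s & s != t.
  apply: contrapT => noS; have Tset1 : T `<=` [set t].
    by move=> s Ts; apply: contrapT => /eqP st; apply: noS; exists s.
  have T1 : T = [set t] by apply/seteqP; split => // _ ->.
  by rewrite T1 lebesgue_measure_set1 ltxx in T_pos.
have [st'|st'|st'] := ltgtP s t; last by rewrite st' eqxx in st.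
- apply: (no_itv (Num.max s (t - e)) t).
    by rewrite gt_max st' ltrBlDr ltrDl e0.
  move=> u /=; rewrite in_itv /= gt_max -andbA => /and3P[su teu ut]; split.
    by apply: (iT s t) => //; rewrite (ltW su) (ltW ut).
  apply: teU; rewrite /ball /= gtr0_norm ?subr_gt0 //; lra.
- apply: (no_itv t (Num.min s (t + e))).
    by rewrite lt_min st' ltrDl e0.
  move=> u /=; rewrite in_itv /= lt_min => /and3P[tu us ute]; split.
    by apply: (iT t s) => //; rewrite (ltW us) (ltW tu).
  apply: teU; rewrite /ball /= distrC gtr0_norm ?subr_gt0 //; lra.
Qed.

(** Convertible to [Psi T Z (x, t) w] when [g] is the section [fun u => Z (x, u) w], which reduces
    the theorem to deterministic functions on [T]. *)
Definition logistic_density T g (t : R) : R :=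
  expR (g t) / \int[mu]_(u in T) expR (g u).

Definition exp_integrable T g :=
  measurable_fun T g /\ (\int[mu]_(u in T) (expR (g u))%:E < +oo)%E.

Section normalised.
Context {T : set R} (mT : measurable T) (T_pos : (0 < mu T)%E).

Lemma integrable_expR {g} : exp_integrable T g ->
  mu.-integrable T (fun u => (expR (g u))%:E).
Proof.
move=> [mg g_fin]; apply/integrableP; split.
  by apply/measurable_realfun.measurable_EFinP; exact: measurableT_comp.
by under eq_integral do rewrite gee0_abs ?lee_fin ?expR_ge0//.
Qed.

(** If the integral vanished, the strictly positive integrand would be zero almost everywhere on
    [T], making [T] negligible. *)
Lemma normaliser_gt0 {g} : exp_integrable T g ->
  0 < \int[mu]_(u in T) expR (g u).
Proof.
move=> ig; have [mg g_fin] := ig.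
(* The real integral is [fine] of the extended one, and [fine] sends [+oo] to [0], so finiteness
   matters here too. *)
apply: fine_gt0; rewrite g_fin andbT lt_neqAle.
rewrite integral_ge0 ?andbT; last by move=> u _; rewrite lee_fin expR_ge0.
apply/eqP => int0.
have : ae_eq mu T (fun u => (expR (g u))%:E) (cst 0%E).
  apply/ae_eq_integral_abs => //.
    by apply/measurable_realfun.measurable_EFinP; exact: measurableT_comp.
  by under eq_integral do rewrite gee0_abs ?lee_fin ?expR_ge0//.
move=> negT; have {}negT : mu.-negligible T.
  apply: negligibleS negT => u Tu /= /(_ Tu) /eqP.
  by rewrite eqe gt_eqF ?expR_gt0.
have T0 := measure_negligible (mu := mu) mT negT.
by move: T_pos; rewrite [mu T]T0 ltxx.
Qed.

Lemma logistic_density_eqP {g h} {t : R} :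
  exp_integrable T g -> exp_integrable T h ->
  logistic_density T g t = logistic_density T h t <->
  g t - h t = ln (\int[mu]_(u in T) expR (g u)) -
              ln (\int[mu]_(u in T) expR (h u)).
Proof.
move=> /normaliser_gt0 Ig /normaliser_gt0 Ih; rewrite /logistic_density.
move: (\int[mu]_(u in T) expR (g u)) Ig (\int[mu]_(u in T) expR (h u)) Ih.
(* Writing each normaliser as the exponential of its logarithm turns both densities into single
   exponentials, and [expR] is injective. *)
move=> I I0 J J0; rewrite -[in X in X <-> _](lnK I0) -[in X in X <-> _](lnK J0).
rewrite -!expRN -!expRD; split; first by move/expR_inj; lra.
by move=> E; congr expR; lra.
Qed.

Lemma increments_eq_logistic_density {g h} :
  exp_integrable T g -> exp_integrable T h ->
  (forall t s, T t -> T s -> g t - g s = h t - h s) <->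
  (forall t, T t -> logistic_density T g t = logistic_density T h t).
Proof.
move=> ig ih; split => [gh t Tt|gh t s Tt Ts]; last first.
  move/(logistic_density_eqP ig ih): (gh t Tt) => ght.
  move/(logistic_density_eqP ig ih): (gh s Ts); rewrite -ght; clear; lra.
rewrite /logistic_density.
(* Equal increments give [g u = h u + (g t - h t)] on [T], with [t] fixed, so the constant factor
   leaves the integral and then cancels in the density. *)
have -> : \int[mu]_(u in T) expR (g u) =
    expR (g t - h t) * \int[mu]_(u in T) expR (h u).
  rewrite -RintegralZl//; last exact: integrable_expR.
  apply: eq_Rintegral => u; rewrite inE => Tu; rewrite -expRD; congr expR.
  by have := gh t u Tt Tu; lra.
rewrite invfM mulrA -expRN -expRD; congr (expR _ / _); lra.
Qed.

Lemma integrable_logistic_density {g} : exp_integrable T g ->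
  mu.-integrable T (fun u => (logistic_density T g u)%:E).
Proof.
move=> /integrable_expR.
exact: (integrableZr (mu := mu) mT (\int[mu]_(u in T) expR (g u))^-1).
Qed.

Lemma logistic_density_eq {g h} :
  is_interval T -> exp_integrable T g -> exp_integrable T h ->
  {within T, continuous g} -> {within T, continuous h} ->
  (forall B, strace measurable T B ->
    (\int[mu]_(u in B) (logistic_density T g u)%:E =
     \int[mu]_(u in B) (logistic_density T h u)%:E)%E) ->
  forall t, T t -> logistic_density T g t = logistic_density T h t.
Proof.
move=> iT ig ih cg ch gh t Tt.
(* Integrable functions with equal integrals over all measurable subsets of [T] agree almost
   everywhere; each such subset is its own trace on [T]. *)
have ae := integral_ae_eq (mu := mu) mT (integrable_logistic_density ig)
  (measurable_int mu (integrable_logistic_density ih)).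
have {}ae := ae (fun B BT mB => gh B (ex_intro2 _ _ B mB (setIidl BT))).
apply: contrapT; rewrite logistic_density_eqP// => /eqP.
set c := (X in _ != X) => ghc.
have /subspace_continuousP/(_ t Tt) :
    {within T, continuous (fun u => g u - h u)}.
  by move=> u; apply: cvgB; [exact: cg|exact: ch].
(* With the distance to [c] as radius, [g - h] avoids [c] on a relative neighbourhood of [t], which
   therefore lies in the null set where the densities differ. *)
move=> /cvgrPdist_lt/(_ `|(g t - h t) - c|).
rewrite normr_gt0 subr_eq0 => /(_ ghc) near_t.
apply: (interval_nbhs_not_negligible iT T_pos Tt near_t).
apply: negligibleS ae => u [Tu /(_ Tu) /= near_u] /(_ Tu) [].
rewrite logistic_density_eqP// -/c => ghu.
by move: near_u; rewrite /from_subspace ghu ltxx.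
Qed.

End normalised.
End logistic_density.

Lemma closed_borel_measurable {I : ptopologicalType} (A : set I) :
  closed A -> measurable (A : set (borelType I)).
Proof.
move=> cA; rewrite -(setCK A); apply: measurableC.
by apply: sub_sigma_algebra; exact: closed_openC.
Qed.

Lemma measurable_field_section {E : ptopologicalType} {R : realType}
    {dOm : measure_display} {Om : measurableType dOm} (D : set E) (T : set R)
    (Z : E * R -> Om -> R) (x : E) (w : Om) :
  closed D -> measurable T -> measurable_field D T Z -> D x ->
  measurable_fun T (fun u => Z (x, u) w).
Proof.
move=> cD mT mZ Dx.
apply: (measurable_comp (F := (D : set (borelType E)) `*` T `*` [set: Om])
  (f := fun p : (borelType E * R * Om)%type => Z p.1 p.2)
  (g := fun u : R => ((x : borelType E), u, w))) => //.
(* Closedness of [D] makes the domain of the jointly measurable field a measurable set. *)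
- by apply: measurableX => //; apply: measurableX => //;
    exact: closed_borel_measurable.
- by move=> _ [u Tu <-].
- by apply: measurable_funTS; apply: measurable_fun_pair => //;
    apply: measurable_fun_pair.
Qed.

Lemma within_continuous_section {E F G : topologicalType} (D : set E)
    (T : set F) (f : E * F -> G) (x : E) : D x ->
  {within D `*` T, continuous f} -> {within T, continuous (fun u => f (x, u))}.
Proof.
move=> Dx cf; apply/subspace_continuousP => t Tt.
have /subspace_continuousP/(_ (x, t) (conj Dx Tt)) ct := cf.
move=> A /ct[[U V] /= [Ux Vt] UVA]; apply: filterS Vt => u Vu Tu.
by apply: UVA => //; split => //=; exact: nbhs_singleton.
Qed.

Theorem proposition2p1 (R : realType)
    (dOm : measure_display) (Om : measurableType dOm) (P : probability Om R)
    (d : nat) (d_ge1 : (1 <= d)%N)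
    (D : set 'rV[R]_d) (D_compact : compact D)
    (D_convex : convex_set (D : set (convex_lmodType 'rV[R]_d)))
    (T : set R) (T_compact : compact T)
    (T_convex : convex_set (T : set (convex_lmodType R^o)))
    (T_pos : (0 < lebesgue_measure T)%E)
    (Z Z' : 'rV[R]_d * R -> Om -> R)
    (Z_meas : measurable_field D T Z)
    (Z'_meas : measurable_field D T Z')
    (Z_exp : exp_integrable_alongside D T Z)
    (Z'_exp : exp_integrable_alongside D T Z') :
  let st1 := indistinguishable P (D `*` T `*` T)
               (increment_field Z) (increment_field Z') in
  let st2 := indistinguishable P (D `*` T) (Psi T Z) (Psi T Z') in
  let st3 := measure_field_indistinguishable P D (strace measurable T)
               (LRPMF T Z) (LRPMF T Z') in
  [/\ st1 <-> st2,
      st2 -> st3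
    & as_continuous P (D `*` T) Z -> separable_field P (D `*` T) Z ->
      as_continuous P (D `*` T) Z' -> separable_field P (D `*` T) Z' ->
      st3 -> st2].
Proof.
have mT : measurable T by exact: measurable_realfun.compact_measurable.
have cD : closed D by apply: compact_closed D_compact; exact: norm_hausdorff.
have iT : is_interval T by exact: convex_set_is_interval.
(* Integrability and measurability of sections hold for every [w], so they cost no null set. *)
have sect (Y : 'rV[R]_d * R -> Om -> R) x w : measurable_field D T Y ->
    exp_integrable_alongside D T Y -> D x ->
    exp_integrable T (fun u => Y (x, u) w).
  by move=> mY iY Dx; split; [exact: measurable_field_section mY Dx|exact: iY].
split.
(* The argument is pathwise: one event serves all indices at once, and no uncountable union of null
   sets arises. *)
- split; apply: filterS => w eqw.
    move=> [x t] [/= Dx Tt].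
    apply: (iffLR (increments_eq_logistic_density mT T_pos
      (sect Z x w Z_meas Z_exp Dx) (sect Z' x w Z'_meas Z'_exp Dx))) => //.
    by move=> s r Ts Tr; exact: (eqw (x, s, r)).
  move=> [[x t] s] [[/= Dx Tt] Ts].
  apply: (iffRL (increments_eq_logistic_density mT T_pos
    (sect Z x w Z_meas Z_exp Dx) (sect Z' x w Z'_meas Z'_exp Dx))) => //.
  by move=> r Tr; exact: (eqw (x, r)).
- apply: filterS => w eqw x _ Dx [A mA <-].
  apply: eq_integral => u; rewrite inE => -[_ Tu].
  by rewrite (eqw (x, u)).
(* The outcome [w] is taken in the intersection of three almost sure events: continuity of each
   field and equality of the measures. *)
- move=> cZ _ cZ' _; apply: filterS3 cZ cZ' => w cZ cZ' eqw [x t] [/= Dx Tt].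
  have eqd := logistic_density_eq mT T_pos iT
    (sect Z x w Z_meas Z_exp Dx) (sect Z' x w Z'_meas Z'_exp Dx)
    (within_continuous_section D T (fun i => Z i w) x Dx cZ)
    (within_continuous_section D T (fun i => Z' i w) x Dx cZ').
  exact: (eqd (fun B BT => eqw x B Dx BT) t Tt).
Qed.
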